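(* Let $p,m,n$ be positive integers with $p>m$, $n>m^2$ and $n\ge17$, and let $d\ge 64\,p\,m^{\frac m2+2}\,4.67^m$. Consider ReLU networks $s^\theta(x)=V\,\mathrm{ReLU}(Wx)$, $\theta=(W,V)\in\mathbb{R}^{d\times p}\times\mathbb{R}^{p\times d}$. Fix $\delta\in(0,1)$ and a constant $c>0$. With probability at least $1-\delta$ over $\mathcal{D}_{\mathrm{train}}\sim\mathcal{D}_m^n$, every interpolating $\theta$ whose normalized margin satisfies \[ \overline{\gamma}_{\theta,\mathrm{ReLU}}:=\frac{\gamma_\theta(\mathcal{D}_{\mathrm{train}})}{\|V\|_2\|W\|_F}\ \ge\ c\cdot\frac{1}{\sqrt p}\cdot\frac{1}{m^{1.5m+2.5}\,6.34^m} \] obeys \[ \mathbb{P}_{(X,Y)\sim\mathcal{D}_m}\big[h_\theta(X)\ne Y\big]\ \le\ \widetilde{\mathcal{O}}\!\left(p\,m^{1.5m+2.5}\,6.34^m\sqrt{\frac mn}\right), \] where $\widetilde{\mathcal{O}}(\cdot)$ hides constants depending only on $c$ and polylogarithmic factors in $n$ and $\delta^{-1}$.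
   Context: Let $[p]=\{0,\dots,p-1\}$, $e_r$ the standard basis of $\mathbb{R}^p$, $\mathcal{X}_m=\{x\in\{0,\dots,m\}^p:\|x\|_1=m\}$. $\mathcal{D}_m$ is the law of $(X,Y)$ with $s_1,\dots,s_m$ i.i.d. uniform on $[p]$, $X=\sum_i e_{s_i}$, $Y=(\sum_i s_i)\bmod p$; $\mathcal{D}_{\mathrm{train}}=\{(x^{(i)},y^{(i)})\}_{i=1}^n$ consists of $n$ i.i.d. draws. $\mathrm{ReLU}(t)=\max\{0,t\}$ entrywise. The predictor is $h_\theta(x)=\ell$ if $s^\theta_\ell(x)>s^\theta_k(x)$ for all $k\ne\ell$, and $\bot$ (an error) otherwise. The margin of $(x,y)$ is $\gamma_\theta(x,y)=s^\theta_y(x)-\max_{k\ne y}s^\theta_k(x)$, $\gamma_\theta(\mathcal{D}_{\mathrm{train}})=\min_i\gamma_\theta(x^{(i)},y^{(i)})$, and $\theta$ is interpolating if $\gamma_\theta(\mathcal{D}_{\mathrm{train}})>0$. $\|V\|_2$ is the spectral norm and $\|W\|_F$ the Frobenius norm. *)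

(* Defs.v *)
From HB Require Import structures.
From mathcomp Require Import all_boot all_order all_algebra.
From mathcomp Require Import boolp classical_sets reals exp.
Set Implicit Arguments. Unset Strict Implicit. Unset Printing Implicit Defensive.
Import Order.TTheory GRing.Theory Num.Theory.
Local Open Scope ring_scope.
Local Open Scope classical_set_scope.

Section Defs.
Variable R : realType.

Definition l2norm (k : nat) (v : 'cV[R]_k) : R :=
  Num.sqrt (\sum_(i < k) v i 0 ^+ 2).

Definition frob (a b : nat) (W : 'M[R]_(a, b)) : R :=
  Num.sqrt (\sum_(i < a) \sum_(j < b) W i j ^+ 2).

Definition specnorm (a b : nat) (V : 'M[R]_(a, b)) : R :=
  sup [set l2norm (V *m x) | x in [set x : 'cV[R]_b | l2norm x = 1]].

Definition relu (a b : nat) (A : 'M[R]_(a, b)) : 'M[R]_(a, b) :=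
  map_mx (fun t => Num.max 0 t) A.

Definition score (p d : nat) (W : 'M[R]_(d, p)) (V : 'M[R]_(p, d))
  (x : 'cV[R]_p) (k : 'I_p) : R :=
  (V *m relu (W *m x)) k 0.

Definition predict (p d : nat) (W : 'M[R]_(d, p)) (V : 'M[R]_(p, d))
  (x : 'cV[R]_p) : option 'I_p :=
  [pick l : 'I_p | [forall k : 'I_p, (k != l) ==> (score W V x k < score W V x l)]].

Definition margin (p d : nat) (W : 'M[R]_(d, p)) (V : 'M[R]_(p, d))
  (x : 'cV[R]_p) (y : 'I_p) : R :=
  score W V x y - sup [set score W V x k | k in [set k : 'I_p | k != y]].

(* a single sample: s_1..s_m in [p]; X = sum e_{s_i}, Y = (sum s_i) mod p *)
Definition sampleX (p m : nat) (s : {ffun 'I_m -> 'I_p}) : 'cV[R]_p :=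
  \col_(j < p) (#|[set i : 'I_m | s i == j]|)%:R.

Definition sampleY (p m : nat) (s : {ffun 'I_m -> 'I_p}) : nat :=
  (\sum_(i < m) (s i : nat)) %% p.

(* margin gamma_theta(X,Y) at a sample; the label Y < p is an element of 'I_p
   (insub never fails since p > 0 whenever 'I_p is inhabited) *)
Definition sample_margin (p m d : nat) (W : 'M[R]_(d, p)) (V : 'M[R]_(p, d))
  (s : {ffun 'I_m -> 'I_p}) : R :=
  oapp (margin W V (sampleX s)) 0 (insub (sampleY s)).

Definition train_margin (p m n d : nat) (W : 'M[R]_(d, p)) (V : 'M[R]_(p, d))
  (S : {ffun 'I_n -> {ffun 'I_m -> 'I_p}}) : R :=
  inf [set sample_margin W V (S i) | i in [set: 'I_n]].

Definition interpolating (p m n d : nat) (W : 'M[R]_(d, p)) (V : 'M[R]_(p, d))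
  (S : {ffun 'I_n -> {ffun 'I_m -> 'I_p}}) : Prop :=
  0 < train_margin W V S.

Definition normalized_margin (p m n d : nat) (W : 'M[R]_(d, p)) (V : 'M[R]_(p, d))
  (S : {ffun 'I_n -> {ffun 'I_m -> 'I_p}}) : R :=
  train_margin W V S / (specnorm V * frob W).

Definition test_error (p m d : nat) (W : 'M[R]_(d, p)) (V : 'M[R]_(p, d)) : R :=
  (#|[set s : {ffun 'I_m -> 'I_p} |
       omap (@nat_of_ord p) (predict W V (sampleX s)) != Some (sampleY s)]|)%:R
  / (p ^ m)%:R.

Definition train_prob (p m n : nat) (E : {ffun 'I_n -> {ffun 'I_m -> 'I_p}} -> Prop) : R :=
  (#|[set S : {ffun 'I_n -> {ffun 'I_m -> 'I_p}} | `[< E S >] ]|)%:R / (p ^ (n * m))%:R.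

End Defs.

(* Main.v *)
Require Import Defs.
From HB Require Import structures.
From mathcomp Require Import all_boot all_order all_algebra.
From mathcomp Require Import boolp classical_sets reals sequences exp.
From mathcomp Require Import ring lra.
Import Order.TTheory GRing.Theory Num.Theory.
Local Open Scope ring_scope.

(* After normalization ||V||_2 <= 1 and ||W||_F = 1, every score is an average
   over neurons, drawn with probability q_j = (|w_j|^2 + |v_j|^2 / ||V||_F^2) / 2,
   of terms of second moment at most 2 m^2 and of size at most m sqrt p.  By the
   exponential Markov inequality, T ~ (m / gamma)^2 log (p^m) sampled neurons
   reproduce all scores on all p^m inputs up to gamma / 8 (Maurey).  Rounding
   the 2 p T remaining parameters to a grid gives a finite class, independent of
   the width d, with logarithmic cardinality ~ p / gamma^2.  A net with margin
   gamma on the sample is approximated by a member of this class with margin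
   above gamma / 2 on the sample; that margin is at most gamma / 2 wherever the
   net errs, so the union bound for consistent hypotheses gives an error of order
   p / (gamma^2 n) ~ (p A)^2 m / n = B^2, where B is the claimed bound.  If B >= 1
   there is nothing to prove; otherwise B^2 <= B, and moreover p <= n and
   m <= ln n, so that all factors polynomial in m and ln p are polylogarithmic
   in n. *)

(** * Exponential moments and Maurey sampling *)

(** From [expR (- u) >= 1 - u] one gets [expR u * (1 - u) <= 1], while the right side times [1 - u]
    equals 1 + u^2 (1 - 2u), which is at least 1 for u <= 1/2. *)
Lemma expR_le_quadratic (R : realType) (u : R) :
  `|u| <= 1 / 2 -> expR u <= 1 + u + 2 * u ^+ 2.
Proof.
rewrite ler_norml => /andP[u1 u2].
have h : 1 - u <= expR (- u) by exact: expR_ge1Dx.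
have h1 : expR u * expR (- u) = 1 by rewrite expRN mulfV // gt_eqF ?expR_gt0.
have h2 : expR u * (1 - u) <= 1 by rewrite -[leRHS]h1 ler_wpM2l ?expR_ge0.
rewrite -(@ler_pM2r _ (1 - u)); last by lra.
apply: (le_trans h2); nra.
Qed.

(** One-sided Chernoff bound for [T] independent draws from [q]. The condition [tau * b <= 2 * s]
    keeps the tilted variable within 1/2, where the quadratic bound on [expR] applies, so the second
    moment [s] rather than [b^2] governs the rate. *)
Lemma mgf_empirical_mean (R : realType) (J : finType) (q Y : J -> R)
    (b s tau : R) (T : nat) :
  (forall j, 0 <= q j) -> \sum_j q j = 1 ->
  (forall j, `|Y j| <= b) -> \sum_j q j * Y j ^+ 2 <= s ->
  0 < s -> 0 < tau -> tau * b <= 2 * s ->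
  \sum_(phi : {ffun 'I_T -> J}) (\prod_t q (phi t)) *
     expR (tau / (4 * s) * \sum_t (Y (phi t) - \sum_j q j * Y j - tau))
  <= expR (- (T%:R * (tau ^+ 2 / (8 * s)))).
Proof.
move=> q0 q1 Yb Ys s0 tau0 taub.
set f := \sum_j q j * Y j; set la := tau / (4 * s).
have la0 : 0 < la by rewrite divr_gt0 ?mulr_gt0.
(* By independence the sum over [phi] is the [T]-th power of a sum over a single draw. *)
under eq_bigr do rewrite mulr_sumr expR_sum -big_split /=.
rewrite -(bigA_distr_bigA (fun (t : 'I_T) j => q j * expR (la * (Y j - f - tau)))) /=.
rewrite prodr_const card_ord -mulrN expRM_natl.
apply: lerXn2r; rewrite ?nnegrE ?expR_ge0 //.
  by apply: sumr_ge0 => j _; rewrite mulr_ge0 ?expR_ge0.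
have step j : q j * expR (la * (Y j - f - tau)) <=
    (q j + la * (q j * Y j) + 2 * la ^+ 2 * (q j * Y j ^+ 2)) * expR (- (la * (f + tau))).
  have -> : la * (Y j - f - tau) = la * Y j + - (la * (f + tau)) by ring.
  rewrite expRD mulrA ler_wpM2r ?expR_ge0 //.
  have -> : q j + la * (q j * Y j) + 2 * la ^+ 2 * (q j * Y j ^+ 2) =
    q j * (1 + la * Y j + 2 * (la * Y j) ^+ 2) by ring.
  apply: ler_wpM2l => //; apply: expR_le_quadratic.
  rewrite normrM (gtr0_norm la0); apply: (@le_trans _ _ (la * b)).
    by rewrite ler_pM2l.
  by rewrite /la mulrAC ler_pdivrMr ?mulr_gt0 //; lra.
apply: (le_trans (ler_sum _ (fun j _ => step j))).
rewrite -mulr_suml !big_split /= -!mulr_sumr q1 -/f.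
(* The choice [la = tau / (4 * s)] minimizes [2 * la^2 * s - la * tau], with value
   [- tau^2 / (8 * s)]; the mean [f] cancels. *)
have -> : - (tau ^+ 2 / (8 * s)) = (la * f + 2 * la ^+ 2 * s) + - (la * (f + tau)).
  by rewrite /la; field; apply/eqP; lra.
rewrite expRD ler_wpM2r ?expR_ge0 //.
apply: le_trans (expR_ge1Dx _).
by rewrite addrA lerD2l ler_wpM2l // mulr_ge0 // sqr_ge0.
Qed.

(** Probabilistic method: if every [phi] failed at some [i], the sum of the exponentials over all
    [i] and both signs would be at least 1 for each [phi]. Its mean is at most [2 * #|I|] times the
    Chernoff bound, which is below 1. *)
Lemma maurey_sampling (R : realType) (J I : finType) (q : J -> R)
    (Z : J -> I -> R) (b s tau : R) (T : nat) :
  (forall j, 0 <= q j) -> \sum_j q j = 1 ->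
  (forall j i, `|Z j i| <= b) -> (forall i, \sum_j q j * Z j i ^+ 2 <= s) ->
  0 < s -> 0 < tau -> tau * b <= 2 * s -> (0 < T)%N ->
  2 * #|I|%:R < expR (T%:R * (tau ^+ 2 / (8 * s))) ->
  exists phi : {ffun 'I_T -> J},
    forall i, `|T%:R^-1 * (\sum_t Z (phi t) i) - \sum_j q j * Z j i| < tau.
Proof.
move=> q0 q1 Zb Zs s0 tau0 taub T0 card_lt.
apply: contrapT => noph.
pose Y (e : bool) i j := (-1) ^+ e * Z j i.
have TR : 0 < T%:R :> R by rewrite ltr0n.
have bad (phi : {ffun 'I_T -> J}) : 1 <= \sum_i \sum_e
    expR (tau / (4 * s) * \sum_t (Y e i (phi t) - \sum_j q j * Y e i j - tau)).
  have [i /negP] : exists i,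
      ~ (`|T%:R^-1 * (\sum_t Z (phi t) i) - \sum_j q j * Z j i| < tau).
    by apply/existsNP => h; apply: noph; exists phi.
  rewrite -leNgt => hi.
  (* The sign of the deviation selects the tail whose exponent is nonnegative. *)
  pose e := T%:R^-1 * (\sum_t Z (phi t) i) - \sum_j q j * Z j i < 0.
  rewrite (bigD1 i) //= (bigD1 e) //= -addrA -[leLHS]addr0 lerD //; last first.
    apply: addr_ge0; apply: sumr_ge0 => *; rewrite ?expR_ge0 //.
    by apply: sumr_ge0 => *; rewrite expR_ge0.
  rewrite -[leLHS]expR0 ler_expR; apply: mulr_ge0.
    by rewrite ltW // divr_gt0 ?mulr_gt0.
  rewrite !sumrB !sumr_const card_ord.
  under [X in X *+ T]eq_bigr do rewrite /Y mulrCA.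
  rewrite /Y -!mulr_sumr.
  have scaleE (sg x y : R) : sg * x - (sg * y) *+ T - tau *+ T =
      T%:R * (sg * (T%:R^-1 * x - y) - tau).
    by rewrite -[_ *+ T]mulr_natl -[tau *+ T]mulr_natl; field; exact: lt0r_neq0.
  rewrite scaleE.
  apply: mulr_ge0; first exact: ltW.
  by rewrite subr_ge0 (le_trans hi) // /e -normrEsign.
have mass : \sum_(phi : {ffun 'I_T -> J}) \prod_t q (phi t) = 1.
  rewrite -(bigA_distr_bigA (fun (t : 'I_T) j => q j)) /=.
  by rewrite prodr_const q1 expr1n.
have : 1 <= \sum_(phi : {ffun 'I_T -> J}) (\prod_t q (phi t)) * \sum_i \sum_e
    expR (tau / (4 * s) * \sum_t (Y e i (phi t) - \sum_j q j * Y e i j - tau)).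
  rewrite -[leLHS]mass; apply: ler_sum => phi _.
  by rewrite ler_peMr // prodr_ge0.
apply/negP; rewrite -ltNge.
under eq_bigr do rewrite mulr_sumr.
rewrite exchange_big /=.
apply: (@le_lt_trans _ _ (\sum_(i : I) \sum_(e : bool) expR (- (T%:R * (tau ^+ 2 / (8 * s)))))).
  apply: ler_sum => i _.
  under eq_bigr do rewrite mulr_sumr.
  rewrite exchange_big /=; apply: ler_sum => e _.
  apply: (@mgf_empirical_mean _ _ _ _ b) => // [j|].
    by rewrite /Y normrM normrX normrN1 expr1n mul1r.
  under eq_bigr do rewrite /Y exprMn sqrr_sign mul1r.
  exact: Zs.
rewrite !sumr_const card_bool -mulrnA -[ltLHS]mulr_natl natrM.
rewrite expRN ltr_pdivrMr ?expR_gt0 // mul1r.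
exact: card_lt.
Qed.

(** * Union bound over a finite class *)

(* Union bound for consistent hypotheses: [B g] is the event on which the
   hypothesis [g] is correct. *)
Lemma card_sample_in_small_event (R : realType) (O G : finType)
    (B : G -> {set O}) (n : nat) (r : R) (E : {set {ffun 'I_n -> O}}) :
  0 <= r ->
  (forall S, S \in E -> exists g, (forall i, S i \in B g) /\ #|B g|%:R <= r) ->
  #|E|%:R <= #|G|%:R * r ^+ n.
Proof.
move=> r0 hE.
pose P g := #|B g|%:R <= r.
have sub : E \subset \bigcup_(g | P g) [set S : {ffun 'I_n -> O} | S \in ffun_on (mem (B g))].
  apply/fintype.subsetP => S /hE[g [hg hr]]; apply/finset.bigcupP; exists g => //.
  by rewrite inE; apply/ffun_onP => i; exact: hg.
have h1 : (#|E| <= \sum_(g | P g) #|B g| ^ n)%N.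
  apply: (leq_trans (subset_leq_card sub)).
  apply: (@leq_trans (\sum_(g | P g) #|[set S : {ffun 'I_n -> O} | S \in ffun_on (mem (B g))]|)).
    elim/big_ind2: _ => [|A x C y hA hC|g _]; rewrite ?cards0 //.
    by rewrite (leq_trans (leq_card_setU _ _)) // leq_add.
  by apply: leq_sum => g _; rewrite cardsE card_ffun_on card_ord.
apply: (@le_trans _ _ (\sum_(g | P g) #|B g|%:R ^+ n)).
  rewrite -(ler_nat R) natr_sum in h1; apply: (le_trans h1).
  by apply: ler_sum => g _; rewrite natrX.
apply: (@le_trans _ _ (\sum_(g | P g) r ^+ n)).
  by apply: ler_sum => g hg; rewrite lerXn2r // nnegrE // (le_trans _ hg).
rewrite sumr_const -[X in X <= _]mulr_natl.
by rewrite ler_wpM2r ?exprn_ge0 // ler_nat max_card.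
Qed.

(** * Rounding of the parameters *)

Lemma grid_approx (R : realType) (u U : R) (K M : nat) :
  (0 < M)%N -> `|u| <= U -> U * M%:R + 1 <= K%:R ->
  exists z : 'I_(2 * K), `|(z%:R - K%:R) / M%:R - u| <= M%:R^-1.
Proof.
move=> M0 uU UK; have MR : 0 < M%:R :> R by rewrite ltr0n.
move: uU; rewrite ler_norml => /andP[u1 u2].
have l1 : - U * M%:R <= u * M%:R by rewrite ler_pM2r.
have l2 : u * M%:R <= U * M%:R by rewrite ler_pM2r.
(* Shifting by [K] makes the value nonnegative, so truncation is a floor; the slack 1 in
   [U * M + 1 <= K] keeps the index below [2 * K]. *)
have y0 : 0 <= u * M%:R + K%:R by lra.
have /andP[h1 h2] := truncn_itv y0.
have zK : (Num.truncn (u * M%:R + K%:R) < 2 * K)%N.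
  by rewrite -(ltr_nat R) natrM (le_lt_trans h1) //; lra.
exists (Ordinal zK) => /=; move: h1 h2; rewrite -natr1.
set z := (Num.truncn _)%:R => h1 h2.
have -> : (z - K%:R) / M%:R - u = (z - K%:R - u * M%:R) / M%:R.
  by field; exact: lt0r_neq0.
rewrite normrM normfV (gtr0_norm MR) ler_pdivrMr // mulVf ?lt0r_neq0 //.
by rewrite ler_norml; apply/andP; split; lra.
Qed.

Lemma max0_lipschitz (R : realType) (a b : R) :
  `|Num.max 0 a - Num.max 0 b| <= `|a - b|.
Proof.
case: (leP 0 a) => ha; case: (leP 0 b) => hb; rewrite ?subrr ?normr0 //.
- by rewrite subr0 !ger0_norm //; lra.
- by rewrite sub0r normrN distrC !ger0_norm //; lra.
Qed.

(** Since [x] has total mass [mu], a change of [eta] in each incoming weight moves the activation by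
    at most [eta * mu]. The perturbed outer weight is at most [P + 1], and the error in the outer
    weight itself adds one more [mu * eta]. *)
Lemma neuron_perturbation (R : realType) (p : nat) (x u u' : 'I_p -> R)
    (a a' P eta mu : R) :
  (forall i, 0 <= x i) -> \sum_i x i = mu ->
  (forall i, `|u i| <= 1) -> `|a| <= P ->
  (forall i, `|u' i - u i| <= eta) -> `|a' - a| <= eta -> eta <= 1 ->
  `|a' * Num.max 0 (\sum_i u' i * x i) - a * Num.max 0 (\sum_i u i * x i)|
    <= (P + 2) * mu * eta.
Proof.
move=> x0 xs u1 aP ud ad e1.
have e0 : 0 <= eta by apply: le_trans ad.
have lin (v : 'I_p -> R) t : (forall i, `|v i| <= t) ->
    `|\sum_i v i * x i| <= t * mu.
  move=> vt; apply: (le_trans (ler_norm_sum _ _ _)); rewrite -xs mulr_sumr.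
  by apply: ler_sum => i _; rewrite normrM (ger0_norm (x0 i)) ler_wpM2r.
set r' := Num.max 0 _; set r := Num.max 0 _.
have dr : `|r' - r| <= eta * mu.
  apply: (le_trans (max0_lipschitz _ _ _)); rewrite -sumrB.
  by under eq_bigr do rewrite -mulrBl; exact: lin.
have hr : `|r| <= 1 * mu.
  have -> : r = r - Num.max 0 0 by rewrite maxxx subr0.
  by apply: (le_trans (max0_lipschitz _ _ _)); rewrite subr0; exact: lin.
have -> : a' * r' - a * r = a' * (r' - r) + (a' - a) * r by ring.
have a'P : `|a'| <= P + 1.
  have -> : a' = a + (a' - a) by ring.
  by apply: (le_trans (ler_normD _ _)); lra.
apply: (le_trans (ler_normD _ _)); rewrite !normrM.
have h1 : `|a'| * `|r' - r| <= (P + 1) * (eta * mu) by apply: ler_pM.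
have h2 : `|a' - a| * `|r| <= eta * (1 * mu) by apply: ler_pM.
lra.
Qed.

(** * Samples, scores and a finite cover of the networks *)

(* The bracket notation of [Defs] denotes classical sets, whose cardinality is
   taken through [asbool]; finite sets are needed for counting. *)
Lemma card_mkset (T : finType) (P : T -> Prop) :
  #|[set x | P x]%classic| = #|[set x : T | `[< P x >]]|.
Proof. by apply: eq_card => x; rewrite [RHS]inE; exact: asbool_equiv_eq. Qed.

Lemma card_mkset_bool (T : finType) (P : pred T) :
  #|[set x | P x]%classic| = #|[set x : T | P x]|.
Proof. by rewrite card_mkset; apply: eq_card => x; rewrite !inE asboolb. Qed.

Lemma sampleX_ge0 (R : realType) {p m : nat} (s : {ffun 'I_m -> 'I_p}) i :
  0 <= sampleX R s i 0.
Proof. by rewrite mxE. Qed.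

Lemma sum_sampleX (R : realType) {p m : nat} (s : {ffun 'I_m -> 'I_p}) :
  \sum_i sampleX R s i 0 = m%:R.
Proof.
under eq_bigr do rewrite mxE.
rewrite -natr_sum; congr _%:R.
under eq_bigr do rewrite card_mkset_bool cardsE -sum1_card big_mkcond.
rewrite exchange_big /= -[RHS]card_ord -sum1_card; apply: eq_bigr => i _.
by rewrite -big_mkcond (big_pred1 (s i)) // => j; rewrite !inE eq_sym.
Qed.

Lemma scoreE (R : realType) (p d : nat) (W : 'M[R]_(d, p)) (V : 'M[R]_(p, d)) x k :
  score W V x k = \sum_j V k j * Num.max 0 (\sum_i W j i * x i 0).
Proof.
rewrite /score mxE; apply: eq_bigr => j _; congr (_ * _).
by rewrite !mxE.
Qed.

(* A net with [T] neurons; [g (t, i, e)] encodes the grid value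
   [(g (t, i, e) - K) / M] of the incoming ([e = true]) or outgoing
   ([e = false]) weight of neuron [t] at coordinate [i]. *)
Definition grid_score (R : realType) (M : nat) {p m T K : nat}
    (g : {ffun 'I_T * 'I_p * bool -> 'I_(2 * K)}) (s : {ffun 'I_m -> 'I_p})
    (k : 'I_p) : R :=
  let c t i e := ((g (t, i, e))%:R - K%:R) / M%:R in
  T%:R^-1 * \sum_t c t k false * Num.max 0 (\sum_i c t i true * sampleX R s i 0).

(** The score is the mean under [q] of [Z j (s, k)]. Sampling [T] neurons costs one [tau], uniformly
    over the p^(m+1) pairs of input and label; rounding the sampled neurons costs the other. *)
Lemma grid_cover (R : realType) (p m d T K M : nat) (W : 'M[R]_(d, p))
    (V : 'M[R]_(p, d)) (tau : R) :
  (0 < p)%N -> (0 < m)%N -> (0 < T)%N -> (0 < M)%N ->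
  (forall k, \sum_j V k j ^+ 2 <= 1) -> \sum_j \sum_i W j i ^+ 2 = 1 ->
  0 < \sum_k \sum_j V k j ^+ 2 ->
  0 < tau -> tau * (m%:R * Num.sqrt p%:R) <= 4 * m%:R ^+ 2 ->
  2 * (p ^ m.+1)%:R < expR (T%:R * (tau ^+ 2 / (16 * m%:R ^+ 2))) ->
  2 * p%:R * M%:R + 1 <= K%:R :> R -> (2 * p%:R + 2) * m%:R / M%:R <= tau ->
  exists g : {ffun 'I_T * 'I_p * bool -> 'I_(2 * K)},
    forall (s : {ffun 'I_m -> 'I_p}) k,
      `|grid_score R M g s k - score W V (sampleX R s) k| < 2 * tau.
Proof.
move=> p0 m0 T0 M0 V1 W1 hV0 tau0 taub hT hK hM.
have pR : 1 <= p%:R :> R by rewrite ler1n.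
have mR : 0 < m%:R :> R by rewrite ltr0n.
have MR : 0 < M%:R :> R by rewrite ltr0n.
have TR : 0 < T%:R :> R by rewrite ltr0n.
pose w j := \sum_i W j i ^+ 2; pose v j := \sum_k V k j ^+ 2.
set hV := \sum_k \sum_j V k j ^+ 2 in hV0.
have hVE : hV = \sum_j v j by rewrite /hV exchange_big.
have hVp : hV <= p%:R.
  by apply: (le_trans (ler_sum _ (fun k _ => V1 k))); rewrite sumr_const card_ord.
have w0 j : 0 <= w j by apply: sumr_ge0 => i _; rewrite sqr_ge0.
have v0 j : 0 <= v j by apply: sumr_ge0 => i _; rewrite sqr_ge0.
have Ww j i : W j i ^+ 2 <= w j.
  by rewrite /w (bigD1 i) //= lerDl sumr_ge0 // => *; rewrite sqr_ge0.
have Vv j k : V k j ^+ 2 <= v j.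
  by rewrite /v (bigD1 k) //= lerDl sumr_ge0 // => *; rewrite sqr_ge0.
(* The first summand controls the second moments, the second one the range;
   neurons with [q j = 0] contribute nothing, in line with [x / 0 = 0]. *)
pose q j := (w j + v j / hV) / 2.
have vh0 j : 0 <= v j / hV by rewrite divr_ge0 // ltW.
have q0 j : 0 <= q j by rewrite /q; have := w0 j; have := vh0 j; lra.
have q1 : \sum_j q j = 1.
  rewrite -mulr_suml big_split /= W1 -mulr_suml -hVE divff ?lt0r_neq0 //.
  by field.
have wq j : w j <= 2 * q j by rewrite /q; have := vh0 j; lra.
have vq j : v j <= 2 * q j * p%:R.
  have : v j <= 2 * q j * hV by rewrite -ler_pdivrMr // /q; have := w0 j; lra.
  by move=> /le_trans; apply; rewrite ler_wpM2l // mulr_ge0.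
pose rr j (s : {ffun 'I_m -> 'I_p}) := Num.max 0 (\sum_i W j i * sampleX R s i 0).
have rr0 j s : 0 <= rr j s by rewrite /rr le_max lexx.
have rrw j (s : {ffun 'I_m -> 'I_p}) : rr j s <= Num.sqrt (w j) * m%:R.
  rewrite /rr ge_max mulr_ge0 ?sqrtr_ge0 //=.
  rewrite -(sum_sampleX R s) mulr_sumr; apply: ler_sum => i _.
  rewrite ler_wpM2r ?sampleX_ge0 //; apply: (le_trans (ler_norm _)).
  by rewrite -sqrtr_sqr ler_wsqrtr.
have qW j : q j = 0 -> forall i, W j i = 0.
  move=> qj i; apply/eqP; rewrite -sqrf_eq0 eq_le sqr_ge0 andbT.
  by rewrite (le_trans (Ww j i)) // (le_trans (wq j)) // qj mulr0.
have qV j : q j = 0 -> forall k, V k j = 0.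
  move=> qj k; apply/eqP; rewrite -sqrf_eq0 eq_le sqr_ge0 andbT.
  by rewrite (le_trans (Vv j k)) // (le_trans (vq j)) // qj mulr0 mul0r.
pose Z j (sk : {ffun 'I_m -> 'I_p} * 'I_p) := V sk.2 j * rr j sk.1 / q j.
have qZ j sk : q j * Z j sk = V sk.2 j * rr j sk.1.
  rewrite /Z; have [qj|qj] := eqVneq (q j) 0; first by rewrite (qV j) // qj !mul0r.
  by field.
(* By the arithmetic-geometric mean inequality and [hV <= p], [q j] is at least sqrt (w_j v_j / p),
   while the numerator of [Z] is at most m sqrt (w_j v_j). *)
have Zb j sk : `|Z j sk| <= m%:R * Num.sqrt p%:R.
  have [qj|qj] := eqVneq (q j) 0.
    by rewrite /Z qj invr0 mulr0 normr0 mulr_ge0 ?sqrtr_ge0.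
  have qp : 0 < q j by rewrite lt_def qj q0.
  rewrite /Z !normrM normfV (gtr0_norm qp) (ger0_norm (rr0 _ _)) ler_pdivrMr //.
  apply: (@le_trans _ _ (Num.sqrt (v j) * (Num.sqrt (w j) * m%:R))).
    by apply: ler_pM => //; rewrite -sqrtr_sqr ler_wsqrtr.
  have sp : 0 < Num.sqrt p%:R :> R by rewrite sqrtr_gt0 ltr0n.
  set al := Num.sqrt (w j); set be := Num.sqrt (v j); set pi := Num.sqrt p%:R in sp *.
  have a2 : al ^+ 2 = w j by rewrite sqr_sqrtr.
  have b2 : be ^+ 2 = v j by rewrite sqr_sqrtr.
  have pi2 : pi ^+ 2 = p%:R by rewrite sqr_sqrtr.
  have h1 : (be / pi) ^+ 2 <= v j / hV.
    by rewrite expr_div_n b2 pi2 ler_wpM2l // lef_pV2 // posrE; lra.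
  have h2 : al * (be / pi) <= q j.
    by rewrite /q -a2; have := sqr_ge0 (al - be / pi); nra.
  have h3 : al * be <= q j * pi by rewrite -ler_pdivrMr // -mulrA.
  have -> : be * (al * m%:R) = m%:R * (al * be) by ring.
  by rewrite -mulrA ler_pM2l // [leRHS]mulrC.
(* Since [rr^2 <= m^2 * w j] and [w j <= 2 * q j], each term is at most 2 m^2 (V_kj)^2, and the rows
   of [V] have norm at most 1. *)
have Zs sk : \sum_j q j * Z j sk ^+ 2 <= 2 * m%:R ^+ 2.
  apply: (@le_trans _ _ (\sum_j V sk.2 j ^+ 2 * (2 * m%:R ^+ 2))); last first.
    by rewrite -mulr_suml ler_piMl // mulr_ge0 // sqr_ge0.
  apply: ler_sum => j _.
  have [qj|qj] := eqVneq (q j) 0.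
    by rewrite qj mul0r mulr_ge0 ?sqr_ge0 ?mulr_ge0 ?sqr_ge0.
  have qp : 0 < q j by rewrite lt_def qj q0.
  have -> : q j * Z j sk ^+ 2 = V sk.2 j ^+ 2 * (rr j sk.1 ^+ 2 / q j).
    by rewrite /Z; field.
  rewrite ler_wpM2l ?sqr_ge0 // ler_pdivrMr //.
  apply: (@le_trans _ _ (w j * m%:R ^+ 2)).
    rewrite -[w j]sqr_sqrtr // -exprMn.
    by rewrite lerXn2r ?nnegrE ?rr0 ?mulr_ge0 ?sqrtr_ge0.
  have := wq j; have := sqr_ge0 (m%:R : R); nra.
have [phi hphi] : exists phi : {ffun 'I_T -> 'I_d}, forall sk,
    `|T%:R^-1 * (\sum_t Z (phi t) sk) - \sum_j q j * Z j sk| < tau.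
  apply: (@maurey_sampling _ _ _ q Z (m%:R * Num.sqrt p%:R) (2 * m%:R ^+ 2)) => //.
  - by rewrite mulr_gt0 // exprn_gt0.
  - by rewrite (le_trans taub) // mulrA -natrM.
  - rewrite card_prod card_ffun !card_ord -expnSr.
    by have -> : 8 * (2 * m%:R ^+ 2) = 16 * m%:R ^+ 2 :> R by ring.
(* Positive homogeneity of ReLU lets the factor [1 / q j] be split between the two layers. With this
   split incoming weights lie in [-1, 1] and outgoing ones in [-2p, 2p], so a bounded grid
   suffices. *)
pose u j i := W j i / Num.sqrt (2 * q j).
pose a j k := 2 * V k j / Num.sqrt (2 * q j).
have u1 j i : `|u j i| <= 1.
  have [qj|qj] := eqVneq (q j) 0; first by rewrite /u qW // mul0r normr0.
  have sq : 0 < Num.sqrt (2 * q j) by rewrite sqrtr_gt0 mulr_gt0 // lt_def qj q0.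
  rewrite normrM normfV (gtr0_norm sq) ler_pdivrMr // mul1r -sqrtr_sqr.
  by rewrite ler_wsqrtr // (le_trans (Ww j i)).
have a1 j k : `|a j k| <= 2 * p%:R.
  have [qj|qj] := eqVneq (q j) 0.
    by rewrite /a qV // mulr0 mul0r normr0 mulr_ge0.
  have sq : 0 < Num.sqrt (2 * q j) by rewrite sqrtr_gt0 mulr_gt0 // lt_def qj q0.
  rewrite !normrM normfV (gtr0_norm sq) ler_pdivrMr // ger0_norm // -mulrA ler_wpM2l //.
  rewrite -[p%:R](ger0_norm (ler0n _ _)) -!sqrtr_sqr -sqrtrM ?sqr_ge0 //.
  rewrite ler_wsqrtr // (le_trans (Vv j k)) // (le_trans (vq j)) // mulrC.
  by apply: ler_wpM2r; [rewrite mulr_ge0|rewrite expr2 ler_peMr].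
have ZE j sk : Z j sk = a j sk.2 * Num.max 0 (\sum_i u j i * sampleX R sk.1 i 0).
  have [qj|qj] := eqVneq (q j) 0; first by rewrite /Z /a qV // mulr0 !mul0r.
  have sq : 0 < Num.sqrt (2 * q j) by rewrite sqrtr_gt0 mulr_gt0 // lt_def qj q0.
  have -> : \sum_i u j i * sampleX R sk.1 i 0 =
      (Num.sqrt (2 * q j))^-1 * \sum_i W j i * sampleX R sk.1 i 0.
    by rewrite mulr_sumr; apply: eq_bigr => i _; rewrite /u; ring.
  rewrite -[X in Num.max X](mulr0 (Num.sqrt (2 * q j))^-1) -maxr_pMr ?invr_ge0 ?ltW //.
  rewrite /Z /a -/(rr j sk.1).
  have sqe : q j = Num.sqrt (2 * q j) ^+ 2 / 2.
    by rewrite sqr_sqrtr; [field|rewrite mulr_ge0].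
  have halfE (x y S : R) : 0 < S -> x * y / (S ^+ 2 / 2) = 2 * x / S * (S^-1 * y).
    by move=> S0; field; exact: lt0r_neq0.
  by rewrite [in LHS]sqe halfE.
have /choice[cf hcf] : forall tie : 'I_T * 'I_p * bool, exists z : 'I_(2 * K),
   `|(z%:R - K%:R) / M%:R - (if tie.2 then u (phi tie.1.1) tie.1.2 else a (phi tie.1.1) tie.1.2)| <= M%:R^-1.
  move=> [[t i] e]; apply: (@grid_approx _ _ (2 * p%:R)) => //=.
  by case: e => //; rewrite (le_trans (u1 _ _)) //; lra.
exists [ffun x => cf x] => s k.
have e1 : M%:R^-1 <= 1 :> R by rewrite invf_le1 ?ler1n.
have -> : score W V (sampleX R s) k = \sum_j q j * Z j (s, k).
  by rewrite scoreE; apply: eq_bigr => j _; rewrite qZ.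
have := hphi (s, k); set F := \sum_j _ => hF.
have hG : `|grid_score R M [ffun x => cf x] s k - T%:R^-1 * (\sum_t Z (phi t) (s, k))| <= tau.
  rewrite /grid_score -mulrBr -sumrB normrM normfV (gtr0_norm TR) mulrC.
  rewrite ler_pdivrMr // (le_trans (ler_norm_sum _ _ _)) //.
  have -> : tau * T%:R = \sum_(t < T) tau by rewrite sumr_const card_ord mulr_natr.
  apply: ler_sum => t _.
  rewrite ZE; apply: (le_trans _ hM).
  apply: neuron_perturbation => //=.
  - by move=> i; exact: sampleX_ge0.
  - exact: sum_sampleX.
  - by move=> i; rewrite ffunE; exact: (hcf (t, i, true)).
  - by rewrite ffunE; exact: (hcf (t, k, false)).
rewrite -(subrKA (T%:R^-1 * (\sum_t Z (phi t) (s, k)))).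
by apply: (le_lt_trans (ler_normD _ _)); lra.
Qed.

(** * Norms, margins and predictions *)

(** Cauchy-Schwarz against a unit vector, from the squared distance of [a] to its projection
    [t * b]. *)
Lemma sqr_dot_le (R : realType) (I : finType) (a b : I -> R) :
  \sum_i b i ^+ 2 = 1 -> (\sum_i a i * b i) ^+ 2 <= \sum_i a i ^+ 2.
Proof.
move=> b1; set t := \sum_i a i * b i.
have : 0 <= \sum_i (a i - t * b i) ^+ 2 by apply: sumr_ge0 => i _; rewrite sqr_ge0.
have -> : \sum_i (a i - t * b i) ^+ 2 =
    \sum_i (a i ^+ 2 - 2 * t * (a i * b i) + t ^+ 2 * b i ^+ 2).
  by apply: eq_bigr => i _; ring.
rewrite big_split /= sumrB -!mulr_sumr b1 -/t; nra.
Qed.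

Lemma sum_sqr_ge0 {R : realType} {I : finType} (a : I -> R) : 0 <= \sum_i a i ^+ 2.
Proof. by apply: sumr_ge0 => i _; rewrite sqr_ge0. Qed.

(** Comparing [specnorm], a [sup], with the value at one vector requires that the set be bounded
    above. *)
Lemma frob_ubound (R : realType) (a b : nat) (V : 'M[R]_(a, b)) :
  ubound [set l2norm (V *m x) | x in [set x : 'cV[R]_b | l2norm x = 1]]%classic (frob V).
Proof.
move=> _ [x /= x1 <-]; rewrite ler_wsqrtr //.
apply: ler_sum => k _; rewrite mxE; apply: sqr_dot_le.
have := sqr_sqrtr (sum_sqr_ge0 (fun i => x i 0)).
by rewrite -/(l2norm x) x1 expr1n.
Qed.

Lemma row_le_specnorm (R : realType) (a b : nat) (V : 'M[R]_(a, b)) k :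
  \sum_j V k j ^+ 2 <= specnorm V ^+ 2.
Proof.
have r0 := sum_sqr_ge0 (fun j => V k j).
have [->|rn] := eqVneq (\sum_j V k j ^+ 2) 0; first exact: sqr_ge0.
set r2 := \sum_j _ in r0 rn *.
pose r := Num.sqrt r2.
have rr : r ^+ 2 = r2 by rewrite sqr_sqrtr.
have rp : 0 < r by rewrite sqrtr_gt0 lt_def rn.
suff hle : r <= specnorm V.
  by rewrite -rr lerXn2r // nnegrE ltW // (lt_le_trans rp hle).
(* On the normalized row [k], the [k]-th coordinate of [V *m x] is the norm of that row. *)
pose x : 'cV[R]_b := \col_j (V k j / r).
have x1 : l2norm x = 1.
  rewrite /l2norm; under eq_bigr do rewrite mxE expr_div_n.
  by rewrite -mulr_suml -/r2 rr divff // sqrtr1.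
apply: (@le_trans _ _ (l2norm (V *m x))); last first.
  apply: ub_le_sup; first by exists (frob V); exact: frob_ubound.
  by exists x.
have hk : (V *m x) k 0 = r.
  rewrite mxE; under eq_bigr do rewrite mxE mulrA -expr2.
  by rewrite -mulr_suml -/r2 -rr expr2 mulfK // lt0r_neq0.
rewrite -[leLHS](gtr0_norm rp) -hk -sqrtr_sqr ler_wsqrtr //.
by rewrite (bigD1 k) //= lerDl sumr_ge0 // => i _; rewrite sqr_ge0.
Qed.

Lemma frob_gt0_specnorm (R : realType) (a b : nat) (V : 'M[R]_(a, b)) :
  0 < specnorm V -> 0 < frob V.
Proof.
move=> s0; rewrite ltNge; apply/negP => f0.
suff : specnorm V <= 0 by rewrite leNgt s0.
(* The set is empty when [b = 0], and then its [sup] is 0 by convention. *)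
rewrite /specnorm; set A := (X in sup X); have [->|ne] := eqVneq A set0.
  by rewrite sup0.
apply: ge_sup; first exact/set0P.
by move=> y /frob_ubound /le_trans; apply.
Qed.

Lemma margin_le (R : realType) (p d : nat) (W : 'M[R]_(d, p)) (V : 'M[R]_(p, d))
    x (y k : 'I_p) : k != y -> margin W V x y <= score W V x y - score W V x k.
Proof.
move=> ky; rewrite lerD2l lerN2; apply: ub_le_sup; last by exists k.
exists (\sum_k `|score W V x k|) => _ [l _ <-].
rewrite (bigD1 l) //=; apply: (le_trans (ler_norm _)).
by rewrite lerDl sumr_ge0.
Qed.

Lemma train_margin_le (R : realType) (p m n d : nat) (W : 'M[R]_(d, p))
    (V : 'M[R]_(p, d)) (S : {ffun 'I_n -> {ffun 'I_m -> 'I_p}}) i :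
  train_margin W V S <= sample_margin W V (S i).
Proof.
apply: ge_inf; last by exists i.
exists (- \sum_i `|sample_margin W V (S i)|) => _ [l _ <-].
rewrite (bigD1 l) //= opprD; apply: (@le_trans _ _ (- `|sample_margin W V (S l)|)).
  by rewrite gerDl oppr_le0 sumr_ge0.
by rewrite lerNl -normrN ler_norm.
Qed.

(** [pick] returns some strict maximizer, and a strict maximizer is unique. *)
Lemma predict_eq (R : realType) (p d : nat) (W : 'M[R]_(d, p)) (V : 'M[R]_(p, d))
    x (y : 'I_p) :
  (forall k, k != y -> score W V x k < score W V x y) -> predict W V x = Some y.
Proof.
move=> hy; rewrite /predict; case: pickP => [l /forallP hl|/(_ y)/negP[]].
  have [->//|ly] := eqVneq l y.
  have := implyP (hl y); rewrite eq_sym => /(_ ly).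
  by rewrite ltNge ltW // hy.
by apply/forallP => k; apply/implyP; exact: hy.
Qed.

Lemma score_scale (R : realType) (p d : nat) (W : 'M[R]_(d, p)) (V : 'M[R]_(p, d))
    (a b : R) x k : 0 <= a ->
  score (a *: W) (b *: V) x k = a * b * score W V x k.
Proof.
move=> a0; rewrite !scoreE mulr_sumr; apply: eq_bigr => j _.
have -> : \sum_i (a *: W) j i * x i 0 = a * \sum_i W j i * x i 0.
  by rewrite mulr_sumr; apply: eq_bigr => i _; rewrite mxE mulrA.
have maxE t : Num.max 0 (a * t) = a * Num.max 0 t by rewrite maxr_pMr // mulr0.
by rewrite maxE mxE; ring.
Qed.

(** * Probabilities as counts, and the margin bound *)

Lemma train_prob_ge (R : realType) (p m n : nat) (delta : R)
    (E : {ffun 'I_n -> {ffun 'I_m -> 'I_p}} -> Prop) :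
  (0 < p)%N ->
  #|[set S | ~~ `[< E S >]]|%:R <= delta * (p ^ (n * m))%:R ->
  1 - delta <= train_prob R E.
Proof.
move=> p0 h; have P0 : 0 < (p ^ (n * m))%:R :> R by rewrite ltr0n expn_gt0 p0.
rewrite /train_prob ler_pdivlMr // mulrBl mul1r lerBlDr.
apply: le_trans (lerD (lexx _) h).
rewrite card_mkset_bool -natrD ler_nat.
have -> : [set S | ~~ `[< E S >]] = ~: [set S | `[< E S >]].
  by apply/setP => S; rewrite !inE.
by rewrite cardsC card_ffun card_ffun !card_ord -expnM mulnC.
Qed.

Lemma test_error_le (R : realType) (p m d : nat) (W : 'M[R]_(d, p))
    (V : 'M[R]_(p, d)) (B : {set {ffun 'I_m -> 'I_p}}) (eps : R) :
  (0 < p)%N ->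
  (forall s, s \in B -> omap (@nat_of_ord p) (predict W V (sampleX R s)) = Some (sampleY s)) ->
  (1 - eps) * (p ^ m)%:R <= #|B|%:R -> test_error m W V <= eps.
Proof.
move=> p0 hB hc; have P0 : 0 < (p ^ m)%:R :> R by rewrite ltr0n expn_gt0 p0.
rewrite /test_error ler_pdivrMr // card_mkset_bool.
set E := finset _.
have : #|E|%:R <= #|~: B|%:R :> R.
  rewrite ler_nat subset_leq_card //; apply/fintype.subsetP => s.
  by rewrite !inE; apply: contraNN => /hB ->.
have : (#|B| + #|~: B|)%:R = (p ^ m)%:R :> R by rewrite cardsC card_ffun !card_ord.
rewrite natrD; lra.
Qed.

(** The cover is used with [tau = gam / 8]: scores are off by less than gam/4 and score differences
    by less than gam/2. Hence a margin [gam] on the sample leaves more than gam/2 for the grid net,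
    and a grid margin above gam/2 certifies that the original net is correct. *)
Lemma margin_generalization (R : realType) (p m n d T K M : nat) (gam eps delta : R) :
  (0 < m)%N -> (m < p)%N -> (0 < T)%N -> (0 < M)%N -> 0 < gam ->
  gam / 8 * (m%:R * Num.sqrt p%:R) <= 4 * m%:R ^+ 2 ->
  2 * (p ^ m.+1)%:R < expR (T%:R * ((gam / 8) ^+ 2 / (16 * m%:R ^+ 2))) ->
  2 * p%:R * M%:R + 1 <= K%:R :> R ->
  (2 * p%:R + 2) * m%:R / M%:R <= gam / 8 ->
  eps <= 1 -> ((2 * K) ^ (T * p * 2))%:R * (1 - eps) ^+ n <= delta ->
  1 - delta <=
    train_prob R (fun S : {ffun 'I_n -> {ffun 'I_m -> 'I_p}} =>
      forall (W : 'M[R]_(d, p)) (V : 'M[R]_(p, d)),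
        interpolating W V S -> gam <= normalized_margin W V S ->
        test_error m W V <= eps).
Proof.
move=> m0 mp T0 M0 gam0 hb hT hK hM eps1 hdelta.
have p0 : (0 < p)%N by apply: leq_trans mp.
apply: train_prob_ge => //.
pose G := {ffun 'I_T * 'I_p * bool -> 'I_(2 * K)}.
(* The event [B g] asks for margin gam/2, not mere correctness, so that it transfers back to the
   original net. *)
pose B (g : G) := [set s : {ffun 'I_m -> 'I_p} | [forall y : 'I_p,
  (nat_of_ord y == sampleY s) ==> [forall k, (k != y) ==>
     (grid_score R M g s k + gam / 2 < grid_score R M g s y)]]].
have ylab (s : {ffun 'I_m -> 'I_p}) : exists y : 'I_p, nat_of_ord y = sampleY s.
  by have h : (sampleY s < p)%N; [rewrite ltn_mod|exists (Ordinal h)].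
pose r := (1 - eps) * (p ^ m)%:R.
have r0 : 0 <= r by rewrite mulr_ge0 // subr_ge0.
apply: (@le_trans _ _ (#|G|%:R * r ^+ n)); last first.
  rewrite card_ffun !card_prod !card_ord card_bool exprMn mulrA -natrX -expnM.
  by rewrite [(m * n)%N]mulnC ler_wpM2r.
apply: (@card_sample_in_small_event _ _ _ B) => // S.
rewrite inE => /asboolPn /existsNP[W] /existsNP[V].
move=> /not_implyP[hint] /not_implyP[hmarg] herr.
set sV := specnorm V in hmarg; set fW := frob W in hmarg.
have fW0 : 0 <= fW by exact: sqrtr_ge0.
(* As [x / 0 = 0], a vanishing product of norms would make the normalized margin 0. *)
have vw0 : 0 < sV * fW.
  have : 0 < train_margin W V S / (sV * fW) by apply: lt_le_trans hmarg.
  by rewrite pmulr_rgt0 // invr_gt0.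
have fWp : 0 < fW by rewrite lt_def fW0 andbT; apply: contraTneq vw0 => ->; rewrite mulr0 ltxx.
have sVp : 0 < sV by rewrite -(pmulr_lgt0 _ fWp).
have sW2 : \sum_j \sum_i W j i ^+ 2 = fW ^+ 2.
  by rewrite sqr_sqrtr // sumr_ge0 // => j _; exact: sum_sqr_ge0.
have sV2 : 0 < \sum_k \sum_j V k j ^+ 2 by rewrite -sqrtr_gt0; exact: frob_gt0_specnorm.
have [g hg] : exists g : G, forall (s : {ffun 'I_m -> 'I_p}) k,
    `|grid_score R M g s k - score (fW^-1 *: W) (sV^-1 *: V) (sampleX R s) k|
      < 2 * (gam / 8).
  apply: grid_cover => //.
  - move=> k.
    have -> : \sum_j (sV^-1 *: V) k j ^+ 2 = (\sum_j V k j ^+ 2) / sV ^+ 2.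
      by rewrite mulr_suml; apply: eq_bigr => j _; rewrite mxE exprMn exprVn mulrC.
    by rewrite ler_pdivrMr ?exprn_gt0 // mul1r; exact: row_le_specnorm.
  - have -> : \sum_j \sum_i (fW^-1 *: W) j i ^+ 2 = (\sum_j \sum_i W j i ^+ 2) / fW ^+ 2.
      rewrite mulr_suml; apply: eq_bigr => j _; rewrite mulr_suml.
      by apply: eq_bigr => i _; rewrite mxE exprMn exprVn mulrC.
    by rewrite sW2 divff // expf_neq0 // lt0r_neq0.
  - have -> : \sum_k \sum_j (sV^-1 *: V) k j ^+ 2 = (\sum_k \sum_j V k j ^+ 2) / sV ^+ 2.
      rewrite mulr_suml; apply: eq_bigr => k _; rewrite mulr_suml.
      by apply: eq_bigr => j _; rewrite mxE exprMn exprVn mulrC.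
    by rewrite divr_gt0 // exprn_gt0.
  - by rewrite divr_gt0.
pose f (s : {ffun 'I_m -> 'I_p}) k := score W V (sampleX R s) k.
have close (s : {ffun 'I_m -> 'I_p}) k l :
    `|(grid_score R M g s l - grid_score R M g s k) - (f s l - f s k) / (sV * fW)| < gam / 2.
  have := hg s k; have := hg s l; rewrite !score_scale ?invr_ge0 //.
  rewrite -/(f s k) -/(f s l) !ltr_norml => /andP[a1 a2] /andP[b1 b2].
  have -> : (f s l - f s k) / (sV * fW) =
      fW^-1 * sV^-1 * f s l - fW^-1 * sV^-1 * f s k.
    by rewrite invfM; ring.
  by apply/andP; split; lra.
exists g; split.
  move=> i; rewrite inE; apply/forallP => y; apply/implyP => /eqP hy.
  apply/forallP => k; apply/implyP => ky.
  have h1 := train_margin_le _ _ _ _ _ W V S i.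
  have h2 : sample_margin W V (S i) = margin W V (sampleX R (S i)) y.
    rewrite /sample_margin; case: insubP => [z _ zE|] /=.
      by congr margin; apply: val_inj; rewrite /= zE hy.
    by rewrite -hy ltn_ord.
  have h3 := margin_le _ _ _ W V (sampleX R (S i)) _ _ ky.
  have h4 : gam <= (f (S i) y - f (S i) k) / (sV * fW).
    apply: (le_trans hmarg); rewrite ler_pM2r ?invr_gt0 //.
    by rewrite (le_trans h1) // h2.
  by have := close (S i) k y; rewrite ltr_norml => /andP[]; lra.
(* If [B g] were larger than [r], the net, being correct on all of [B g], would have test error at
   most [eps]. *)
rewrite leNgt; apply/negP => hr; apply: herr.
apply: (@test_error_le _ _ _ _ _ _ (B g)) => //; last exact: ltW.
move=> s; rewrite inE => /forallP hs; have [y hy] := ylab s.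
rewrite (@predict_eq _ _ _ _ _ _ y) /= ?hy // => k ky.
have := hs y; rewrite hy eqxx => /forallP/(_ k); rewrite ky /= => h1.
have := close s k y; rewrite ltr_norml => /andP[_ h2].
have : 0 < (f s y - f s k) / (sV * fW) by move: h2; rewrite ltrBlDr; lra.
by rewrite pmulr_lgt0 ?invr_gt0 // subr_gt0.
Qed.

(** * Numerical estimates *)

Lemma test_error_le1 (R : realType) (p m d : nat) (W : 'M[R]_(d, p)) (V : 'M[R]_(p, d))
    (eps : R) : (0 < p)%N -> 1 <= eps -> test_error m W V <= eps.
Proof.
move=> p0 e1; apply: (@test_error_le _ _ _ _ _ _ finset.set0) => // [s|].
  by rewrite inE.
by rewrite cards0 mulr_le0_ge0 // subr_le0.
Qed.

Lemma expR1_le4 (R : realType) : expR 1 <= 4 :> R.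
Proof.
have h : 1 + - (1 / 2) <= expR (- (1 / 2)) :> R by exact: expR_ge1Dx.
have h1 : expR (1 / 2) * expR (- (1 / 2)) = 1 :> R.
  by rewrite expRN mulfV // gt_eqF ?expR_gt0.
have e0 := expR_gt0 (1 / 2 : R).
have h2 : expR (1 / 2) <= 2 :> R by nra.
have -> : 1 = 1 / 2 + 1 / 2 :> R by field.
by rewrite expRD; nra.
Qed.

(** Here e^m <= 6.34^m <= A <= A^2 <= n, so powers of [m] count as logarithmic factors. *)
Lemma size_le_ln_samples (R : realType) (m : nat) (A n : R) :
  (634 / 100) ^+ m <= A -> 0 < n -> A ^+ 2 <= n -> 1 <= A -> m%:R <= ln n.
Proof.
move=> eA n0 A2n A1.
rewrite -ler_expR lnK ?posrE // -[m%:R]mulr1 expRM_natl.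
apply: (@le_trans _ _ ((634 / 100) ^+ m)).
  rewrite lerXn2r ?nnegrE ?expR_ge0 ?divr_ge0 //.
  by apply: (le_trans (expR1_le4 R)); rewrite ler_pdivlMr // -natrM ler_nat.
by apply: (le_trans eA); apply: le_trans A2n; rewrite expr2 ler_peMr // (le_trans ler01).
Qed.

(** The logarithm of the class size plus that of 1/delta must be at most [eps * n]. Up to constants,
    [T * p] is p^2 A^2 m = B^2 n times m (m + 2) L, and B^2 <= B. In L^4, one factor comes from [T],
    two from m (m + 2) <= 3 L^2 and one from [lnK]. *)
Lemma sample_budget (R : realFieldType) (c0 L A B p m n T lnK lnd : R) :
  1 <= c0 -> 1 <= L -> 1 <= A -> 1 <= p -> 1 <= m -> m <= L -> 1 <= n ->
  0 <= B -> B <= 1 -> B ^+ 2 * n = p ^+ 2 * A ^+ 2 * m ->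
  0 <= T -> T <= 2 * (1024 * c0 ^+ 2 * m ^+ 2 * (m + 2) * p * A ^+ 2 * L) ->
  0 <= lnK -> lnK <= 194 * c0 * L -> lnd <= L ->
  T * p * 2 * lnK + lnd <= (4 * 3072 * 194 * c0 ^+ 3 + 1) * L ^+ 4 * B * n.
Proof.
move=> c01 L1 A1 p1 m1 mL n1 B0 B1 B2 T0 TX lnK0 hlnK hlnd.
have ge0 (x : R) : 1 <= x -> 0 <= x by apply: le_trans ler01.
have [[[[[c00 L0] A0] p0] m0] n0] := (ge0 _ c01, ge0 _ L1, ge0 _ A1, ge0 _ p1, ge0 _ m1, ge0 _ n1).
pose Q := c0 ^+ 2 * (p * A ^+ 2 * m).
have Q0 : 0 <= Q by rewrite !mulr_ge0 ?exprn_ge0.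
have TQ : T <= 6144 * Q * L ^+ 3.
  apply: (le_trans TX).
  have h1 : m * (m + 2) <= 3 * L ^+ 2 by clear -L1 m1 mL; nra.
  have -> : 2 * (1024 * c0 ^+ 2 * m ^+ 2 * (m + 2) * p * A ^+ 2 * L) =
     2048 * Q * L * (m * (m + 2)) by rewrite /Q; ring.
  have -> : 6144 * Q * L ^+ 3 = 2048 * Q * L * (3 * L ^+ 2) by ring.
  by rewrite ler_wpM2l // !mulr_ge0.
have h1 : T * p * 2 * lnK <= 6144 * Q * L ^+ 3 * p * 2 * (194 * c0 * L).
  by apply: ler_pM => //; rewrite ?mulr_ge0 // ler_wpM2r // ler_wpM2r.
have h2 : 6144 * Q * L ^+ 3 * p * 2 * (194 * c0 * L)
   = 4 * 3072 * 194 * c0 ^+ 3 * L ^+ 4 * (B ^+ 2 * n) by rewrite B2 /Q; ring.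
(* The square of [B * n] is p^2 A^2 m n. This lets the summand 1 of the constant absorb [lnd]. *)
have h3 : 1 <= B * n.
  rewrite -(@ler_sqr _ 1 _) ?nnegrE ?mulr_ge0 // expr1n exprMn.
  have -> : B ^+ 2 * n ^+ 2 = B ^+ 2 * n * n by ring.
  by rewrite B2 !mulr_ege1 // exprn_ege1.
have h4 : 4 * 3072 * 194 * c0 ^+ 3 * L ^+ 4 * (B ^+ 2 * n) <=
    4 * 3072 * 194 * c0 ^+ 3 * L ^+ 4 * (B * n).
  apply: ler_wpM2l; first by rewrite !mulr_ge0 ?exprn_ge0.
  by rewrite ler_wpM2r // expr2 ler_piMl.
have h5 : lnd <= L ^+ 4 * (B * n).
  apply: (le_trans hlnd); apply: (@le_trans _ _ (L ^+ 4)).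
    by rewrite exprS ler_peMr ?exprn_ege1.
  by rewrite ler_peMr // exprn_ge0.
have -> : (4 * 3072 * 194 * c0 ^+ 3 + 1) * L ^+ 4 * B * n =
   4 * 3072 * 194 * c0 ^+ 3 * L ^+ 4 * (B * n) + L ^+ 4 * (B * n) by ring.
by rewrite lerD // (le_trans h1) // h2.
Qed.

(** The grid has at most 192 c0 n^2 values because p <= n; 194 is 192 from [ln (192 * c0)] plus 2
    from [ln (n^2)]. *)
Lemma ln_grid_size (R : realType) (c0 p n L x : R) :
  1 <= c0 -> 1 <= p -> p <= n -> 1 <= n -> ln n <= L -> 1 <= L ->
  0 < x -> x <= 2 * (2 * p * (32 * c0 * n) + 1) ->
  ln x <= 194 * c0 * L.
Proof.
move=> c01 p1 pn n1 lnL L1 x0 hx.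
have h : x <= 192 * c0 * n ^+ 2.
  apply: (le_trans hx).
  have h1 : 1 <= p * (c0 * n) by rewrite !mulr_ege1.
  have : 0 <= c0 * n * (n - p) by rewrite !mulr_ge0 ?subr_ge0 //; lra.
  nra.
have z0 : 0 < 192 * c0 by lra.
have n0 : 0 < n by lra.
have : ln x <= ln (192 * c0 * n ^+ 2).
  by rewrite ler_ln ?posrE // (lt_le_trans x0 h).
rewrite lnM ?posrE ?exprn_gt0 // lnXn // mulr2n.
have : ln (192 * c0) <= 192 * c0 - 1.
  have {1}-> : 192 * c0 = 1 + (192 * c0 - 1) by ring.
  by apply: le_ln1Dx; lra.
have : 192 * c0 <= 192 * c0 * L by rewrite ler_peMr // ltW.
have : L <= c0 * L by rewrite ler_peMl // (le_trans ler01).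
lra.
Qed.

(** It suffices that p m sqrt p A <= n: its square is (p^2 A^2 m)(p m), and both factors are at most
    [n]. *)
Lemma grid_resolution (R : rcfType) (c0 p m n A : R) :
  1 <= c0 -> 1 <= p -> 1 <= m -> 1 <= A -> p ^+ 2 * A ^+ 2 * m <= n ->
  (2 * p + 2) * m / (32 * c0 * n) <= (c0 * Num.sqrt p * A)^-1 / 8.
Proof.
move=> c01 p1 m1 A1 hn.
have ge0 (x : R) : 1 <= x -> 0 <= x by apply: le_trans ler01.
have gt0 (x : R) : 1 <= x -> 0 < x by apply: lt_le_trans ltr01.
have [[[c00 A0] p0] m0] := (ge0 _ c01, ge0 _ A1, ge0 _ p1, ge0 _ m1).
have s0 : 0 < Num.sqrt p by rewrite sqrtr_gt0 gt0.
have s2 : Num.sqrt p ^+ 2 = p by rewrite sqr_sqrtr.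
set s := Num.sqrt p in s0 s2 *.
have pm1 : 1 <= p * m by rewrite mulr_ege1.
have A2 : 1 <= A ^+ 2 by rewrite exprn_ege1.
have pmn : p * m <= n.
  apply: le_trans hn; have -> : p ^+ 2 * A ^+ 2 * m = p * m * (p * A ^+ 2) by ring.
  by rewrite ler_peMr ?mulr_ge0 // mulr_ege1.
have n0 : 0 < n by apply: lt_le_trans pmn; exact: gt0.
have key : p * m * s * A <= n.
  have key0 : 0 <= p * m * s * A by rewrite !mulr_ge0 // ltW.
  rewrite -ler_sqr ?nnegrE ?(ltW n0) //.
  have -> : (p * m * s * A) ^+ 2 = p ^+ 2 * A ^+ 2 * m * (p * m).
    by rewrite !exprMn s2; ring.
  by rewrite [leRHS]expr2 ler_pM // !mulr_ge0 ?exprn_ge0.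
have [c0p Ap] := (gt0 _ c01, gt0 _ A1).
have d0 : 0 < 32 * c0 * n by rewrite !mulr_gt0.
have g0 : 0 < c0 * s * A by rewrite !mulr_gt0.
rewrite ler_pdivrMr // mulrAC ler_pdivlMr // [leRHS]mulrC ler_pdivlMr //.
have h : (2 * p + 2) * (m * s * A) <= 4 * n.
  apply: (@le_trans _ _ (4 * (p * m * s * A))); last by rewrite ler_pM2l.
  have : 0 <= m * s * A by rewrite !mulr_ge0 // ltW.
  nra.
have -> : (2 * p + 2) * m * 8 * (c0 * s * A) = 8 * c0 * ((2 * p + 2) * (m * s * A)) by ring.
have -> : 32 * c0 * n = 8 * c0 * (4 * n) by ring.
by rewrite ler_wpM2l // mulr_ge0.
Qed.

(** * Choice of the parameters and conclusion *)

Theorem mainTheorem7 (R : realType) (c : R) (hc : 0 < c) :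
  exists (C : R) (k : nat), 0 < C /\
  forall (p m n d : nat) (delta : R),
    (0 < m)%N -> (m < p)%N -> (m ^ 2 < n)%N -> (17 <= n)%N ->
    64 * p%:R * Num.sqrt ((m ^ (m + 4))%:R) * (467 / 100) ^+ m <= (d%:R : R) ->
    0 < delta -> delta < 1 ->
    1 - delta <=
    train_prob R (fun S : {ffun 'I_n -> {ffun 'I_m -> 'I_p}} =>
      forall (W : 'M[R]_(d, p)) (V : 'M[R]_(p, d)),
        interpolating W V S ->
        c * (Num.sqrt (p%:R))^-1 *
          (Num.sqrt ((m ^ (3 * m + 5))%:R) * (634 / 100) ^+ m)^-1
          <= normalized_margin W V S ->
        test_error m W V <=
          C * (1 + ln (n%:R) + ln delta^-1) ^+ k *
          (p%:R * Num.sqrt ((m ^ (3 * m + 5))%:R) * (634 / 100) ^+ m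
           * Num.sqrt (m%:R / n%:R))).
Proof.
(* An integer [c0 >= 1 / c] replaces [c], so that the grid size below is a natural number. *)
have [c0 c00 cc0] : exists2 c0, (0 < c0)%N & 1 <= c0%:R * c.
  exists (Num.truncn c^-1).+1 => //; rewrite -ler_pdivrMr // div1r ltW //.
  by have /andP[] := truncn_itv (ltW (etrans (invr_gt0 c) hc)).
have c01 : 1 <= c0%:R :> R by rewrite ler1n.
have C10 : 0 <= 4 * 3072 * 194 * c0%:R ^+ 3 :> R by rewrite !mulr_ge0 ?exprn_ge0.
have C11 : 1 <= 4 * 3072 * 194 * c0%:R ^+ 3 + 1 :> R by rewrite lerDr.
exists (4 * 3072 * 194 * c0%:R ^+ 3 + 1), 4%N; split; first exact: lt_le_trans C11.
move=> p m n d delta m0 mp _ n17 _ d0 d1.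
move: C10 C11; set C := _ + 1 => C10 C11.
(* [q] is m^(1.5m+2.5); with [A = q * e] the margin threshold is c / (sqrt p A). *)
have [q qE] : {q : R | q = Num.sqrt (m ^ (3 * m + 5))%:R} by eexists.
have [e eE] : {e : R | e = (634 / 100) ^+ m} by eexists.
have [L LE] : {L : R | L = 1 + ln n%:R + ln delta^-1} by eexists.
rewrite -qE -eE -LE.
have p0 : (0 < p)%N by apply: leq_trans mp.
have n0 : (0 < n)%N by apply: leq_trans n17.
have p1 : 1 <= p%:R :> R by rewrite ler1n.
have m1 : 1 <= m%:R :> R by rewrite ler1n.
have n1 : 1 <= n%:R :> R by rewrite ler1n.
have lnn0 : 0 <= ln n%:R :> R by rewrite ln_ge0.
have lnd0 : 0 <= ln delta^-1 by rewrite ln_ge0 // invf_ge1 // ltW.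
have lnnL : ln n%:R <= L by rewrite LE addrAC lerDr addr_ge0.
have lndL : ln delta^-1 <= L by rewrite LE lerDr addr_ge0.
have L1 : 1 <= L by rewrite LE -addrA lerDl addr_ge0.
have q1 : 1 <= q by rewrite qE -[leLHS]sqrtr1 ler_wsqrtr // ler1n expn_gt0 m0.
have e1 : 1 <= e by rewrite eE exprn_ege1 // ler_pdivlMr // mul1r ler_nat.
have [A AE] : {A | A = q * e} by eexists.
have A1 : 1 <= A by rewrite AE mulr_ege1.
have eA : e <= A by rewrite AE ler_peMl // (le_trans ler01).
have [B BE] : {B : R | B = p%:R * q * e * Num.sqrt (m%:R / n%:R)} by eexists.
rewrite -AE -BE.
have A0 : 0 < A by apply: lt_le_trans A1.
have B0 : 0 <= B.
  by rewrite BE -[_ * q * e]mulrA -AE !mulr_ge0 ?sqrtr_ge0 // ltW.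
have CL : 1 <= C * L ^+ 4 by rewrite mulr_ege1 // exprn_ege1.
(* A claimed bound of at least 1 holds for every net, so no training sample is bad. *)
have [eps1|eps1] := leP 1 (C * L ^+ 4 * B).
  apply: train_prob_ge => //; rewrite (_ : [set _ | _] = finset.set0).
    by rewrite cards0 mulr_ge0 // ltW.
  apply/setP => S; rewrite !inE; apply/negbTE; rewrite negbK; apply/asboolP.
  by move=> *; exact: test_error_le1.
have B1 : B <= 1.
  by apply: ltW; apply: le_lt_trans eps1; rewrite ler_peMl.
have B2 : B ^+ 2 * n%:R = p%:R ^+ 2 * A ^+ 2 * m%:R.
  rewrite BE -[_ * q * e]mulrA -AE !exprMn sqr_sqrtr ?divr_ge0 //.
  by rewrite mulrA divfK // pnatr_eq0 -lt0n.
(* From here on [n] dominates p^2 A^2 m, hence also [p] and, exponentially, [m]. *)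
have B2n : p%:R ^+ 2 * A ^+ 2 * m%:R <= n%:R.
  by rewrite -B2 ler_piMl // expr_le1.
have pn : p%:R <= n%:R :> R.
  apply: le_trans B2n.
  have -> : p%:R ^+ 2 * A ^+ 2 * m%:R = p%:R * (p%:R * A ^+ 2 * m%:R) :> R by ring.
  rewrite ler_peMr //.
  by rewrite !mulr_ege1 // exprn_ege1.
have mL : m%:R <= L.
  apply: le_trans lnnL; apply: (@size_le_ln_samples _ _ A) => //.
  - by rewrite -eE.
  - by rewrite ltr0n.
  - apply: le_trans B2n; rewrite mulrAC ler_peMl ?sqr_ge0 //.
    by rewrite mulr_ege1 // exprn_ege1.
have sp0 : 0 < Num.sqrt p%:R :> R by rewrite sqrtr_gt0 ltr0n.
have sp2 : Num.sqrt p%:R ^+ 2 = p%:R :> R by rewrite sqr_sqrtr.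
pose gam := (c0%:R * Num.sqrt p%:R * A)^-1.
have g0 : 0 < c0%:R * Num.sqrt p%:R * A by rewrite !mulr_gt0 ?ltr0n.
have gam0 : 0 < gam by rewrite invr_gt0.
(* [X] solves [X * ((gam / 8)^2 / (16 * m^2)) = (m + 2) * L] exactly, with 1024 = 64 * 16; [T > X]
   then gives the strict inequality needed for sampling. *)
have [X XE] : {X : R | X = 1024 * c0%:R ^+ 2 * m%:R ^+ 2 * (m%:R + 2) * p%:R * A ^+ 2 * L}.
  by eexists.
have X1 : 1 <= X.
  rewrite XE !mulr_ege1 ?exprn_ege1 ?ler1n //.
  by rewrite -natrD ler1n addn_gt0 m0.
pose T := (Num.truncn X).+1.
have /andP[TX1 TX2] := truncn_itv (le_trans ler01 X1).
have TX : T%:R <= 2 * X by rewrite mulr2n mulrDl mul1r -natr1 lerD.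
pose M := (32 * c0 * n)%N; pose K := (2 * p * M + 1)%N.
have ME : M%:R = 32 * c0%:R * n%:R :> R by rewrite !natrM.
have KE : K%:R = 2 * p%:R * M%:R + 1 :> R by rewrite natrD !natrM.
have K0 : (0 < 2 * K)%N by rewrite muln_gt0 /K addn1.
have lnK_le : ln (2 * K)%:R <= 194 * c0%:R * L :> R.
  apply: (@ln_grid_size _ _ p%:R n%:R) => //; first by rewrite ltr0n.
  by rewrite natrM KE ME.
have budget := @sample_budget R c0%:R L A B p%:R m%:R n%:R T%:R (ln (2 * K)%:R)
  (ln delta^-1) c01 L1 A1 p1 m1 mL n1 B0 B1 B2 (ler0n _ _).
have {}budget : T%:R * p%:R * 2 * ln (2 * K)%:R + ln delta^-1 <= C * L ^+ 4 * B * n%:R.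
  by apply: budget => //; rewrite -?XE // ln_ge0 // ler1n.
have p_pos : (p%:R : R) \is Num.pos by rewrite posrE ltr0n.
have K_pos : ((2 * K)%:R : R) \is Num.pos by rewrite posrE ltr0n.
have delta_pos : delta \is Num.pos by rewrite posrE.
have main := @margin_generalization R p m n d T K M gam (C * L ^+ 4 * B) delta m0 mp isT.
have {main} main : 1 - delta <= train_prob R
   (fun S : {ffun 'I_n -> {ffun 'I_m -> 'I_p}} =>
      forall (W : 'M[R]_(d, p)) (V : 'M[R]_(p, d)),
        interpolating W V S -> gam <= normalized_margin W V S ->
        test_error m W V <= C * L ^+ 4 * B).
  apply: main => //.
  - by rewrite !muln_gt0 c00.
  - have -> : gam / 8 * (m%:R * Num.sqrt p%:R) = m%:R / (8 * (c0%:R * A)).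
      rewrite /gam; field.
      by rewrite !lt0r_neq0 ?ltr0n.
    apply: (@le_trans _ _ m%:R).
      rewrite ler_pdivrMr ?mulr_gt0 ?ltr0n // ler_peMr //.
      by rewrite !mulr_ege1 ?ler1n.
    by rewrite expr2 mulrA ler_peMl // mulr_ege1 ?ler1n.
  (* As p >= 2, the factor 2 is absorbed into p^(m+2), and ln p <= ln n <= L. *)
  - apply: (@le_lt_trans _ _ (expR ((m%:R + 2) * L))).
      apply: (@le_trans _ _ (p ^ (m + 2))%:R).
        by rewrite -natrM ler_nat addn2 [leqRHS]expnS leq_mul // (leq_ltn_trans m0).
      rewrite natrX -(lnK p_pos) -expRM_natl ler_expR natrD.
      rewrite ler_wpM2l ?addr_ge0 //; apply: le_trans lnnL.
      by rewrite ler_ln ?posrE ?ltr0n.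
    rewrite ltr_expR.
    have XgE : X * ((gam / 8) ^+ 2 / (16 * m%:R ^+ 2)) = (m%:R + 2) * L.
      rewrite XE /gam -[in _ * p%:R]sp2; field.
      by rewrite !lt0r_neq0 ?ltr0n.
    have g8 : 0 < gam / 8 by rewrite divr_gt0.
    have m2 : 0 < m%:R ^+ 2 :> R by rewrite exprn_gt0 ?ltr0n.
    by rewrite -XgE ltr_pM2r // divr_gt0 ?[0 < 16 * _]mulr_gt0 // exprn_gt0.
  - by rewrite KE.
  - by rewrite ME; exact: grid_resolution.
  - exact: ltW.
  (* With (1 - eps)^n <= exp (- n eps), the condition becomes the budget inequality in
     logarithms. *)
  - apply: (@le_trans _ _ (expR (T%:R * p%:R * 2 * ln (2 * K)%:R) *
        expR (n%:R * - (C * L ^+ 4 * B)))).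
      apply: ler_pM => //; first by rewrite exprn_ge0 // subr_ge0 ltW.
        rewrite natrX -{1}(lnK K_pos) -expRM_natl.
        by rewrite !natrM.
      rewrite expRM_natl lerXn2r ?nnegrE ?expR_ge0 ?subr_ge0 ?(ltW eps1) //.
      exact: expR_ge1Dx.
    rewrite -expRD -[leRHS](lnK delta_pos) ler_expR.
    move: budget; rewrite lnV ?posrE // mulrN [n%:R * _]mulrC => budget.
    by rewrite lerBlDr -lerBlDl.
(* The threshold of the statement is [c0 * c * gam >= gam], so its event contains the one just
   bounded. *)
apply: (le_trans main); rewrite /train_prob ler_wpM2r ?invr_ge0 //.
rewrite ler_nat !card_mkset_bool subset_leq_card //; apply/fintype.subsetP => S.
rewrite !inE => /asboolP h; apply/asboolP => W V hint hm; apply: h => //.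
apply: le_trans hm.
have -> : c / Num.sqrt p%:R / A = c0%:R * c * gam.
  by rewrite /gam; field; rewrite !lt0r_neq0 ?ltr0n.
by rewrite ler_peMl // ltW.
Qed.
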